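(* Let $A$ be a $d\times d$ real matrix for which all eigenvalues have negative real parts. Let $\sigma\in C([0,\infty);\mathbb{R}^{d\times r})$, let $\xi\in\mathbb{R}^d$, let $Y$ be the unique continuous adapted process which obeys \[ dY(t)=-Y(t)\,dt+\sigma(t)\,dB(t),\quad t\ge 0;\quad Y(0)=0, \] and let $X$ be the unique continuous adapted process which obeys \[ dX(t)=AX(t)\,dt+\sigma(t)\,dB(t),\quad t\ge 0;\quad X(0)=\xi. \] Then: (A) If $\lim_{t\to\infty}Y(t)=0$ a.s., then $\lim_{t\to\infty}X(t)=0$ a.s. (B) If there exist $0\le c_1\le c_2<+\infty$ such that \[ c_1\le \liminf_{t\to\infty}\|Y(t)\|\le \limsup_{t\to\infty}\|Y(t)\|\le c_2,\quad\text{a.s.}, \] then there exist $0\le c_3\le c_4<+\infty$ such that \[ c_3\le \liminf_{t\to\infty}\|X(t)\|\le \limsup_{t\to\infty}\|X(t)\|\le c_4,\quad\text{a.s.} \] (C) If $\limsup_{t\to\infty}\|Y(t)\|=+\infty$ a.s., then $\limsup_{t\to\infty}\|X(t)\|=+\infty$ a.s.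
   Context: $d$ and $r$ are positive integers, $B$ is an $r$-dimensional standard Brownian motion, $\sigma$ is deterministic, $C([0,\infty);\mathbb{R}^{d\times r})$ is the space of continuous functions from $[0,\infty)$ to the real $d\times r$ matrices, and $\|\cdot\|$ is the Euclidean norm on $\mathbb{R}^d$. *)

(* Defs.v *)
From HB Require Import structures.
From mathcomp Require Import all_boot all_order all_algebra.
From mathcomp Require Import all_classical all_reals all_analysis.
From mathcomp.real_closed Require Import complex.

Set Implicit Arguments.
Unset Strict Implicit.
Unset Printing Implicit Defensive.

Import Order.TTheory GRing.Theory Num.Theory.
Import numFieldNormedType.Exports.

Local Open Scope classical_set_scope.
Local Open Scope ring_scope.

Definition enorm (R : realType) (d : nat) (v : 'cV[R]_d) : R :=
  Num.sqrt (\sum_(i < d) v i 0 ^+ 2).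

Definition limsup_pinfty (R : realType) (f : R -> R) : \bar R :=
  limf_esup (EFin \o f) (pinfty_nbhs R).

Definition liminf_pinfty (R : realType) (f : R -> R) : \bar R :=
  limf_einf (EFin \o f) (pinfty_nbhs R).

Definition all_eigenvalues_re_neg (R : realType) (d : nat) (A : 'M[R]_d) : Prop :=
  forall z : R[i], eigenvalue (map_mx (real_complex R) A) z -> complex.Re z < 0.

(* Time is the half-line [0, +oo[ of R: the values at negative times of the
   families F, B, X and of the function sigma below are irrelevant. *)
Definition continuous_on_halfline (R : realType) (U : topologicalType)
    (f : R -> U) : Prop :=
  {within [set t : R | 0 <= t], continuous f}.

Section Processes.
Context {R : realType} {dT : measure_display} {T : measurableType dT}.
Variables (P : probability T R) (F : R -> set (set T)).

Definition is_filtration : Prop :=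
  (forall t, 0 <= t -> sigma_algebra setT (F t) /\ F t `<=` measurable) /\
  (forall s t, 0 <= s -> s <= t -> F s `<=` F t).

Definition measurable_at (t : R) (f : T -> R) : Prop :=
  forall U : set R, measurable U -> F t (f @^-1` U).

Definition adapted (n : nat) (X : R -> T -> 'cV[R]_n) : Prop :=
  forall t, 0 <= t -> forall i, measurable_at t (fun w => X t w i 0).

Definition continuous_process (n : nat) (X : R -> T -> 'cV[R]_n) : Prop :=
  {ae P, forall w, continuous_on_halfline (fun t => X t w)}.

(* Standard r-dimensional Brownian motion relative to the filtration F. The
   scale parameter of normal_prob is the standard deviation. The last clause is
   the joint independence of F s and of the r coordinates of B t - B s. *)
Record is_brownian_motion (r : nat) (B : R -> T -> 'cV[R]_r) : Prop := {
  brownian_adapted : adapted B ;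
  brownian_start : {ae P, forall w, B 0 w = 0} ;
  brownian_continuous : continuous_process B ;
  brownian_gaussian : forall s t, 0 <= s -> s < t -> forall i (U : set R),
    measurable U ->
    P [set w | U ((B t w - B s w) i 0)] = normal_prob 0 (Num.sqrt (t - s)) U ;
  brownian_independent : forall s t, 0 <= s -> s < t ->
    forall (E : set T) (U : 'I_r -> set R),
    F s E -> (forall i, measurable (U i)) ->
    P (E `&` [set w | forall i, U i ((B t w - B s w) i 0)]) =
    (P E * \prod_(i < r) P [set w | U i ((B t w - B s w)%R i 0%R)])%E }.

(* Encodes the simple process equal to step_coef k on
   ]step_time k, step_time k.+1] for k < step_size, and to 0 elsewhere. *)
Record step_process := StepProcess {
  step_size : nat ;
  step_time : nat -> R ;
  step_coef : nat -> T -> R }.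

Definition is_simple_process (t : R) (phi : step_process) : Prop :=
  [/\ step_time phi 0%N = 0,
      step_time phi (step_size phi) = t,
      forall k, (k < step_size phi)%N ->
        step_time phi k <= step_time phi k.+1,
      forall k, (k < step_size phi)%N ->
        measurable_at (step_time phi k) (step_coef phi k) &
      forall k, (k < step_size phi)%N ->
        exists C : R, forall w, `|step_coef phi k w| <= C].

Definition step_value (phi : step_process) (s : R) (w : T) : R :=
  \sum_(k < step_size phi)
    step_coef phi k w * \1_`]step_time phi k, step_time phi k.+1] s.

Definition step_integral (W : R -> T -> R) (phi : step_process) (w : T) : R :=
  \sum_(k < step_size phi)
    step_coef phi k w * (W (step_time phi k.+1) w - W (step_time phi k) w).

(* phi_n --> f in L^2([0, t] x T). *)
Definition approximates (t : R) (f : R -> T -> R) (phi : nat -> step_process) :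
    Prop :=
  (forall n, is_simple_process t (phi n)) /\
  (\int[P]_w \int[lebesgue_measure]_(s in `[0%R, t])
     ((f s w - step_value (phi n) s w) ^+ 2)%R%:E)%E @[n --> \oo] --> 0%E.

(* I is (a version of) the Ito integral of f against W over [0, t]: the common
   limit in L^2(P) of the integrals of the simple processes approximating f. *)
Definition is_ito_integral (W : R -> T -> R) (t : R) (f : R -> T -> R)
    (I : T -> R) : Prop :=
  [/\ measurable_fun setT I,
      exists phi, approximates t f phi &
      forall phi, approximates t f phi ->
        (\int[P]_w ((step_integral W (phi n) w - I w) ^+ 2)%R%:E)%E
          @[n --> \oo] --> 0%E].

Definition is_ito_integral_mx (d r : nat) (B : R -> T -> 'cV[R]_r) (t : R)
    (sigma : R -> 'M[R]_(d, r)) (M : T -> 'cV[R]_d) : Prop :=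
  exists I : 'I_d -> 'I_r -> T -> R,
    (forall i j, is_ito_integral (fun s w => B s w j 0) t
                   (fun s _ => sigma s i j) (I i j)) /\
    (forall w i, M w i 0 = \sum_(j < r) I i j w).

(* X is a continuous adapted solution of
     dX(t) = b(X(t)) dt + sigma(t) dB(t),  t >= 0,   X(0) = x0,
   in integral form. Since the paths of X are continuous, requiring the integral
   equation almost surely at each time t amounts to requiring that almost
   surely it holds at all times, for the continuous version of the stochastic
   integral. *)
Definition is_sde_solution (d r : nat) (B : R -> T -> 'cV[R]_r)
    (b : 'cV[R]_d -> 'cV[R]_d) (sigma : R -> 'M[R]_(d, r)) (x0 : 'cV[R]_d)
    (X : R -> T -> 'cV[R]_d) : Prop :=
  [/\ adapted X,
      continuous_process X,
      {ae P, forall w, X 0 w = x0} &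
      forall t, 0 <= t -> exists M : T -> 'cV[R]_d,
        is_ito_integral_mx B t sigma M /\
        {ae P, forall w, X t w =
           x0 + \col_(i < d) Rintegral lebesgue_measure `[0, t]
                                (fun s => b (X s w) i 0) + M w}].

End Processes.

(* Main.v *)
Require Import Defs.
From HB Require Import structures.
From mathcomp Require Import all_boot all_order all_algebra.
From mathcomp Require Import all_classical all_reals all_analysis.
From mathcomp.real_closed Require Import complex.
From mathcomp Require Import measurable_realfun ring lra.

Set Implicit Arguments.
Unset Strict Implicit.
Unset Printing Implicit Defensive.

Import Order.TTheory GRing.Theory Num.Theory.
Import numFieldNormedType.Exports.

Local Open Scope classical_set_scope.
Local Open Scope ring_scope.

(** The noise enters both equations through the same stochastic integral, so it
    cancels in the difference Z = X - Y, which satisfies an ordinary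
    differential equation path by path. Indeed Z' = A X + Y, and this can be
    read in two ways:
      Z' =   A Z + (1 + A) Y    and    Z' = - Z + (1 + A) X.
    Both A and -1 have their spectrum in the open left half-plane. So, by the
    first reading, an eventual bound c on Y gives an eventual bound K c on Z,
    hence on X; by the second, an eventual bound on X gives one on Y. The
    constant K depends on A alone ([comparison_bound]). Letting c tend to 0
    yields (A), a fixed c yields (B), with 0 as the lower bound, and the second
    reading yields (C) by contraposition.

    The estimate for z' = A z + f ([stable_bounded]) is obtained without matrix
    exponentials or Lyapunov functions. If l_1, ..., l_n are the complex roots
    of the characteristic polynomial, and m is a row vector, then the scalars
    w_k = m (A - l_1) ... (A - l_k) z satisfy
      w_k' = l_(k+1) w_k + w_(k+1) + m (A - l_1) ... (A - l_k) f,
    and w_n = 0 by Cayley-Hamilton. A backward induction thus reduces the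
    estimate to scalar equations w' = l w + g with Re l < 0, for which |w|^2
    satisfies a linear differential inequality ([damped_rotation_bound]).

    On the stochastic side, what matters is that a version of the stochastic
    integral is determined almost surely ([ito_integral_unique]). This gives the
    integral equation for Z almost surely at each fixed time, hence almost
    surely at all positive rational times, hence at all positive times by
    continuity of paths ([sde_difference], [is_derive_difference]). *)

(** * Scalar differential inequalities *)

Section Scalar.
Context {R : realType}.

(** Gronwall's argument: [expR (mu * t) * (V t - C / mu)] is eventually
    nonincreasing, so [V t - C / mu] is at most a constant times
    [expR (- (mu * t))]. *)
Lemma decay_bound (mu C e : R) (V V' : R -> R) : 0 < mu -> 0 < e ->
  (\forall t \near +oo,
    is_derive t (1 : R) V (V' t) /\ V' t <= - mu * V t + C) ->
  \forall t \near +oo, V t <= C / mu + e.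
Proof.
move=> mu0 e0 [t0 [_ dV]].
pose a := t0 + 1.
have t0a : t0 < a by rewrite ltrDl.
pose phi t := expR (mu * t) * (V t - C / mu).
have dphi t : t0 < t -> is_derive t (1 : R) phi
    (expR (mu * t) * (V' t + mu * V t - C)).
  move=> /dV [Vt _].
  have dexp : is_derive t (1 : R) (fun s => expR (mu * s)) (mu * expR (mu * t)).
    have := @is_derive1_comp _ (@expR R) (fun s => mu * s) t
              (expR (mu * t)) mu (is_derive_expR _).
    rewrite mulrC; apply.
    by apply: is_derive_eq; rewrite /GRing.scale/= mulr1.
  have dVC : is_derive t (1 : R) (fun s => V s - C / mu) (V' t).
    by apply: is_derive_eq; rewrite subr0.
  apply: is_derive_eq; rewrite /GRing.scale/=.
  by field; rewrite gt_eqF.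
have phia t : a <= t -> phi t <= phi a.
  move=> le_at.
  have dphi' x : x \in `]a, t[ -> is_derive x (1 : R) phi
    (expR (mu * x) * (V' x + mu * V x - C)).
    by rewrite in_itv/= => /andP[ax _]; apply: dphi; exact: lt_trans ax.
  apply: (@ler0_derive1_le_cc _ phi a t) => //;
    rewrite ?in_itv/= ?lexx ?le_at//.
  - by move=> x /dphi'[].
  - move=> x xat; have dx := dphi' x xat; rewrite derive1E derive_val.
    apply: mulr_ge0_le0; first exact: expR_ge0.
    move: xat; rewrite in_itv/= => /andP[ax _].
    have [_ ] := dV x (lt_trans t0a ax); lra.
  - apply: derivable_within_continuous => x; rewrite in_itv/= => /andP[ax _].
    by have [] := dphi x (lt_le_trans t0a ax).
have cvg0 : phi a * expR (- (mu * t)) @[t --> +oo] --> phi a * 0.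
  have muty : mu * t @[t --> +oo] --> +oo.
    apply: gt0_cvgMry => //; exact: cvg_id.
  exact: cvgMl_tmp (cvg_comp _ _ muty (@cvgr_expR R)).
rewrite mulr0 in cvg0.
near=> t.
have phit : phi t <= phi a.
  by apply: phia; near: t; apply: nbhs_pinfty_ge; exact: num_real.
have small : phi a * expR (- (mu * t)) < e by near: t; exact: (cvgr_lt _ cvg0).
rewrite -lerBlDl (le_trans _ (ltW small))// expRN ler_pdivlMr ?expR_gt0//.
by rewrite mulrC.
Unshelve. all: by end_near. Qed.

(** The complex equation w' = l w + (g + i h), with w = a + i b and
    l = - mu + i nu, in real coordinates. The rotation nu disappears from the
    derivative of |w|^2, and Young's inequality turns it into
    (|w|^2)' <= - mu |w|^2 + c^2 / mu. The limit bound (c / mu)^2 is relaxed to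
    (2 c / mu)^2 so as to hold eventually. *)
Lemma damped_rotation_bound (mu nu c : R) (a b g h : R -> R) :
  0 < mu -> 0 < c ->
  (\forall t \near +oo, is_derive t (1 : R) a (- mu * a t - nu * b t + g t)) ->
  (\forall t \near +oo, is_derive t (1 : R) b (nu * a t - mu * b t + h t)) ->
  (\forall t \near +oo, g t ^+ 2 + h t ^+ 2 <= c ^+ 2) ->
  \forall t \near +oo, a t ^+ 2 + b t ^+ 2 <= (2 / mu * c) ^+ 2.
Proof.
move=> mu0 c0 da db gh.
have e0 : 0 < 3 * (c / mu) ^+ 2 by rewrite mulr_gt0// exprn_gt0// divr_gt0.
have -> : (2 / mu * c) ^+ 2 = (c ^+ 2 / mu) / mu + 3 * (c / mu) ^+ 2.
  by field; rewrite gt_eqF.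
apply: (@decay_bound mu _ _ (fun t => a t ^+ 2 + b t ^+ 2) (fun t =>
    2 * (- mu * (a t ^+ 2 + b t ^+ 2) + a t * g t + b t * h t))) => //.
near=> t; split.
  have dat : is_derive t (1 : R) a (- mu * a t - nu * b t + g t) by near: t.
  have dbt : is_derive t (1 : R) b (nu * a t - mu * b t + h t) by near: t.
  by apply: is_derive_eq; rewrite /GRing.scale/=; ring.
have ght : g t ^+ 2 + h t ^+ 2 <= c ^+ 2 by near: t.
have -> : - mu * (a t ^+ 2 + b t ^+ 2) + c ^+ 2 / mu =
  2 * (- mu * (a t ^+ 2 + b t ^+ 2) + a t * g t + b t * h t)
  + ((mu * a t - g t) ^+ 2 + (mu * b t - h t) ^+ 2) / mu
  + (c ^+ 2 - (g t ^+ 2 + h t ^+ 2)) / mu.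
  by field; rewrite gt_eqF.
rewrite -[leRHS]addrA lerDl addr_ge0// divr_ge0 ?subr_ge0 ?(ltW mu0)//.
by rewrite addr_ge0 ?sqr_ge0.
Unshelve. all: by end_near. Qed.

End Scalar.

(** * Linear systems with spectrum in the left half-plane *)

Section Stability.
Context {R : realType}.

Definition eventually_solves n (A : 'M[R]_n) (z f : R -> 'cV[R]_n) : Prop :=
  \forall t \near +oo, forall i,
    is_derive t (1 : R) (fun s => z s i 0) ((A *m z t + f t) i 0).

Definition eventually_bounded n (c : R) (f : R -> 'cV[R]_n) : Prop :=
  \forall t \near +oo, forall i, `|f t i 0| <= c.

(** Derivatives are only taken of real functions, so a complex linear form
    applied to a real vector is handled through its real and imaginary parts. *)
Definition Re_mx m n (M : 'M[R[i]]_(m, n)) : 'M[R]_(m, n) :=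
  map_mx (@complex.Re R) M.
Definition Im_mx m n (M : 'M[R[i]]_(m, n)) : 'M[R]_(m, n) :=
  map_mx (@complex.Im R) M.

(** One factor A - l at a time, so that the product over all roots makes sense
    for rows of any size, including zero. *)
Definition shift_row n (A : 'M[R]_n) (m : 'rV[R[i]]_n) (l : R[i]) :=
  m *m map_mx (real_complex R) A - l *: m.

Lemma is_derive_rowmul n (p : 'rV[R]_n) (z : R -> 'cV[R]_n) (v : 'cV[R]_n)
    (t : R) : (forall i, is_derive t (1 : R) (fun s => z s i 0) (v i 0)) ->
  is_derive t (1 : R) (fun s => (p *m z s) 0 0) ((p *m v) 0 0).
Proof.
move=> dz; rewrite mxE.
have -> : (fun s => (p *m z s) 0 0) =
    \sum_(j < n) (fun s => p 0 j * z s j 0).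
  by apply/funext => s; rewrite mxE fct_sumE.
by apply: is_derive_sum => j; have dzj := dz j; exact: is_deriveZ.
Qed.

Lemma rowmul_bound n (p : 'rV[R]_n) : exists2 K : R, 0 <= K &
  forall (x : 'cV[R]_n) (c : R), (forall i, `|x i 0| <= c) ->
    `|(p *m x) 0 0| <= K * c.
Proof.
exists (\sum_j `|p 0 j|); first by apply: sumr_ge0.
move=> x c xc; rewrite mxE mulr_suml; apply: le_trans (ler_norm_sum _ _ _) _.
by apply: ler_sum => j _; rewrite normrM ler_wpM2l.
Qed.

Lemma ReD (x y : R[i]) : complex.Re (x + y) = complex.Re x + complex.Re y.
Proof. by case: x y => [? ?] [? ?]. Qed.

Lemma ImD (x y : R[i]) : complex.Im (x + y) = complex.Im x + complex.Im y.
Proof. by case: x y => [? ?] [? ?]. Qed.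

Lemma Re_shift_row n (A : 'M[R]_n) m l : Re_mx m *m A = Re_mx (shift_row A m l)
  + complex.Re l *: Re_mx m - complex.Im l *: Im_mx m.
Proof.
rewrite /Re_mx /Im_mx /shift_row; apply/rowP => k.
rewrite !mxE ReD (big_morph _ ReD (erefl : complex.Re (0 : R[i]) = 0)).
rewrite [in LHS](eq_bigr (fun j => complex.Re
    (m 0 j * map_mx (real_complex R) A j k))); last first.
  by move=> j _; rewrite !mxE; case: (m 0 j) => [? ?]/=; ring.
by case: l (m 0 k) => [? ?] [? ?]/=; ring.
Qed.

Lemma Im_shift_row n (A : 'M[R]_n) m l : Im_mx m *m A = Im_mx (shift_row A m l)
  + complex.Im l *: Re_mx m + complex.Re l *: Im_mx m.
Proof.
rewrite /Re_mx /Im_mx /shift_row; apply/rowP => k.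
rewrite !mxE ImD (big_morph _ ImD (erefl : complex.Im (0 : R[i]) = 0)).
rewrite [in LHS](eq_bigr (fun j => complex.Im
    (m 0 j * map_mx (real_complex R) A j k))); last first.
  by move=> j _; rewrite !mxE; case: (m 0 j) => [? ?]/=; ring.
by case: l (m 0 k) => [? ?] [? ?]/=; ring.
Qed.

(** Induction on the roots: writing w = m z and m' = m (A - l), one has
    w' = l w + (m' z + m f), where m' z is controlled by the induction
    hypothesis and m f by the bound on f. The constant has to be chosen before
    z, f and c, because the theorem needs a bound that is uniform over the
    paths. *)
Lemma annihilated_row_bounded n (A : 'M[R]_n) (s : seq R[i])
    (m : 'rV[R[i]]_n) :
  (forall l, l \in s -> complex.Re l < 0) -> foldl (shift_row A) m s = 0 ->
  exists2 K : R, 0 <= K & forall z f, eventually_solves A z f ->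
    forall c : R, 0 < c -> eventually_bounded c f ->
    \forall t \near +oo,
      (Re_mx m *m z t) 0 0 ^+ 2 + (Im_mx m *m z t) 0 0 ^+ 2 <= (K * c) ^+ 2.
Proof.
elim: s m => [|l s IHs] m /= s_lt0 ms0.
  exists 0 => // z f _ c _ _; near=> t.
  have -> : Re_mx m = 0 by apply/matrixP => i j; rewrite ms0 !mxE.
  have -> : Im_mx m = 0 by apply/matrixP => i j; rewrite ms0 !mxE.
  by rewrite !mul0mx !mxE mul0r expr0n addr0.
have /IHs /(_ ms0) [K1 K1_ge0 IH] : forall k, k \in s -> complex.Re k < 0.
  by move=> k ks; apply: s_lt0; rewrite inE ks orbT.
have mu0 : 0 < - complex.Re l by rewrite oppr_gt0 s_lt0// mem_head.
have [Kp Kp_ge0 pK] := rowmul_bound (Re_mx m).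
have [Kq Kq_ge0 qK] := rowmul_bound (Im_mx m).
(* Crude bound on |m' z + m f| / c, made positive by the final 1. *)
pose C := 2 * (K1 + Kp + Kq) + 1.
have C0 : 0 < C by rewrite /C; lra.
exists (2 / - complex.Re l * C).
  by rewrite mulr_ge0 ?divr_ge0// ltW.
move=> z f zf c c0 fc; rewrite -(mulrA _ C c).
pose m' := shift_row A m l.
apply: (@damped_rotation_bound _ (- complex.Re l) (complex.Im l) (C * c)
  (fun t => (Re_mx m *m z t) 0 0) (fun t => (Im_mx m *m z t) 0 0)
  (fun t => (Re_mx m' *m z t) 0 0 + (Re_mx m *m f t) 0 0)
  (fun t => (Im_mx m' *m z t) 0 0 + (Im_mx m *m f t) 0 0)) => //.
- by rewrite mulr_gt0.
- near=> t.
  have : forall i, is_derive t (1 : R) (fun s => z s i 0)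
    ((A *m z t + f t) i 0) by near: t.
  move=> /(is_derive_rowmul (Re_mx m)) dz; apply: is_derive_eq.
  rewrite mulmxDr mulmxA (Re_shift_row A m l) !mulmxDl mulNmx -!scalemxAl !mxE.
  ring.
- near=> t.
  have : forall i, is_derive t (1 : R) (fun s => z s i 0)
    ((A *m z t + f t) i 0) by near: t.
  move=> /(is_derive_rowmul (Im_mx m)) dz; apply: is_derive_eq.
  rewrite mulmxDr mulmxA (Im_shift_row A m l) !mulmxDl -!scalemxAl !mxE.
  ring.
- near=> t.
  have ftc : forall i, `|f t i 0| <= c by near: t.
  have : (Re_mx m' *m z t) 0 0 ^+ 2 + (Im_mx m' *m z t) 0 0 ^+ 2
    <= (K1 * c) ^+ 2 by near: t; exact: IH zf _ c0 fc.
  have /ler_normlP[] := pK _ _ ftc.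
  have /ler_normlP[] := qK _ _ ftc.
  move: ((Re_mx m' *m z t) 0 0) ((Im_mx m' *m z t) 0 0) ((Re_mx m *m f t) 0 0)
    ((Im_mx m *m f t) 0 0) => x y u v v1 v2 u1 u2 xy.
  have u3 : u ^+ 2 <= (Kp * c) ^+ 2 by nra.
  have v3 : v ^+ 2 <= (Kq * c) ^+ 2 by nra.
  have c_ge0 := ltW c0.
  have x1 : 0 <= K1 * c by rewrite mulr_ge0.
  have x2 : 0 <= Kp * c by rewrite mulr_ge0.
  have x3 : 0 <= Kq * c by rewrite mulr_ge0.
  have -> : C * c = 2 * (K1 * c + Kp * c + Kq * c) + c by rewrite /C; ring.
  have : (x + u) ^+ 2 + (y + v) ^+ 2 <=
    2 * (x ^+ 2 + y ^+ 2) + 2 * u ^+ 2 + 2 * v ^+ 2.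
    rewrite -subr_ge0.
    have -> : 2 * (x ^+ 2 + y ^+ 2) + 2 * u ^+ 2 + 2 * v ^+ 2 -
      ((x + u) ^+ 2 + (y + v) ^+ 2) = (x - u) ^+ 2 + (y - v) ^+ 2 by ring.
    by rewrite addr_ge0// sqr_ge0.
  move=> /le_trans; apply.
  have : 2 * (K1 * c) ^+ 2 + 2 * (Kp * c) ^+ 2 + 2 * (Kq * c) ^+ 2 <=
    (2 * (K1 * c + Kp * c + Kq * c) + c) ^+ 2 by nra.
  lra.
Unshelve. all: by end_near. Qed.

Lemma foldl_shift_row n (A : 'M[R]_n.+1) (s : seq R[i]) m :
  foldl (shift_row A) m s =
    m *m \prod_(l <- s) (map_mx (real_complex R) A - l%:M).
Proof.
elim: s m => [|l s IHs] m /=; first by rewrite big_nil mulmx1.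
by rewrite IHs big_cons mulmxA mulmxBr mul_mx_scalar.
Qed.

(** By Cayley-Hamilton, every row is annihilated by the product of the factors
    A - l over the roots l of the characteristic polynomial; the coordinates of
    z come from the rows of the identity matrix. *)
Lemma stable_bounded n (A : 'M[R]_n) : all_eigenvalues_re_neg A ->
  exists2 K : R, 0 <= K & forall z f, eventually_solves A z f ->
    forall c : R, 0 < c -> eventually_bounded c f ->
    eventually_bounded (K * c) z.
Proof.
case: n A => [|n] A hA.
  by exists 0 => // z f _ c _ _; near=> t => -[].
pose AC := map_mx (real_complex R) A.
have [s char_s] := closed_field_poly_normal (char_poly AC).
rewrite (eqP (char_poly_monic AC)) scale1r in char_s.
have s_lt0 l : l \in s -> complex.Re l < 0.
  move=> ls; apply: hA; rewrite eigenvalue_root_char char_s.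
  by rewrite root_prod_XsubC.
have prod0 : \prod_(l <- s) (AC - l%:M) = 0.
  rewrite -(Cayley_Hamilton AC) char_s rmorph_prod; apply: eq_bigr => l _.
  by rewrite rmorphB/= horner_mx_X horner_mx_C.
have row_bound i : exists2 K : R, 0 <= K &
    forall z f, eventually_solves A z f ->
    forall c : R, 0 < c -> eventually_bounded c f ->
    \forall t \near +oo, `|z t i 0| <= K * c.
  pose e : 'rV[R[i]]_n.+1 := delta_mx 0 i.
  have [|K K_ge0 zK] := @annihilated_row_bounded _ A s e s_lt0.
    by rewrite foldl_shift_row prod0 mulmx0.
  exists K => // z f zf c c0 fc; near=> t.
  have : (Re_mx e *m z t) 0 0 ^+ 2 +
         (Im_mx e *m z t) 0 0 ^+ 2 <= (K * c) ^+ 2.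
    by near: t; exact: (zK _ _ zf _ c0 fc).
  have -> : Re_mx e = delta_mx 0 i.
    by apply/matrixP => j k; rewrite !mxE; case: (_ && _).
  have -> : Im_mx e = 0.
    by apply/matrixP => j k; rewrite !mxE; case: (_ && _).
  rewrite -rowE mul0mx !mxE expr0n addr0 -real_normK ?num_real//.
  by rewrite ler_pXn2r// nnegrE mulr_ge0// ltW.
have {row_bound} /choice [K /all_and2 [K_ge0 zK]] : forall i, exists K : R,
    0 <= K /\ forall z f, eventually_solves A z f ->
    forall c : R, 0 < c -> eventually_bounded c f ->
    \forall t \near +oo, `|z t i 0| <= K * c.
  by move=> i; have [K] := row_bound i; exists K.
exists (\sum_i K i); first exact: sumr_ge0.
move=> z f zf c c0 fc; apply: filter_forall => i.
near=> t; have /le_trans : `|z t i 0| <= K i * c.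
  by near: t; exact: (zK i _ _ zf _ c0 fc).
by apply; rewrite ler_pM2r// (bigD1 i)//= lerDl sumr_ge0.
Unshelve. all: by end_near. Qed.

Lemma stableN1 n : all_eigenvalues_re_neg (- 1%:M : 'M[R]_n).
Proof.
move=> z /eigenvalueP [v]; rewrite map_mxN map_mx1 mulmxN mulmx1 => vz v0.
have : (z + 1) *: v = 0 by rewrite scalerDl scale1r -vz addNr.
move/eqP; rewrite scaler_eq0 (negbTE v0) orbF addr_eq0 => /eqP ->/=.
by rewrite oppr_lt0.
Qed.

End Stability.

(** * Paths of the difference of the two solutions *)

Section Paths.
Context {R : realType}.

Lemma halfline_continuous_at (g : R -> R) (t : R) :
  continuous_on_halfline g -> 0 < t -> {for t, continuous g}.
Proof.
move=> cg t0.
have cg1 : {within `[0, t + 1], continuous g}.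
  by apply: continuous_subspaceW cg => s /=; rewrite in_itv/= => /andP[].
apply: within_continuous_continuous cg1 _; first by rewrite addr_gt0.
by rewrite in_itv/= t0 ltrDl ltr01.
Qed.

Lemma is_derive_integral (g : R -> R) (t : R) :
  continuous_on_halfline g -> 0 < t ->
  is_derive t (1 : R)
    (fun s => Rintegral lebesgue_measure `[0, s] g) (g t).
Proof.
move=> cg t0.
have t1 : t < t + 1 by rewrite ltrDl.
have cg1 : {within `[0, t + 1], continuous g}.
  by apply: continuous_subspaceW cg => s /=; rewrite in_itv/= => /andP[].
have ig := continuous_compact_integrable (@segment_compact _ 0 (t + 1)) cg1.
have [dG <-] :=
  continuous_FTC1_closed t1 ig t0 (halfline_continuous_at cg t0).
by rewrite derive1E; exact: derivableP.
Qed.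

Lemma continuous_rowmul n (p : 'rV[R]_n) :
  continuous (fun v : 'cV[R]_n => (p *m v) 0 0).
Proof.
have -> : (fun v : 'cV[R]_n => (p *m v) 0 0) =
    (fun v => \sum_j p 0 j * v j 0) by apply/funext => v; rewrite mxE.
apply: continuous_big => [|j _ v]; first exact: add_continuous.
apply: cvgMl_tmp; first exact: (@nbhs_filter 'cV[R]_n v).
exact: coord_continuous.
Qed.

Lemma continuous_on_halfline_mulmx m n (M : 'M[R]_(m, n)) i
    (x : R -> 'cV[R]_n) : continuous_on_halfline x ->
  continuous_on_halfline (fun t => (M *m x t) i 0).
Proof.
move=> cx t; have -> : (fun s => (M *m x s) i 0) =
    (fun v => (row i M *m v) 0 0) \o x.
  by apply/funext => s /=; rewrite -row_mul [RHS]mxE.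
apply: (@continuous_comp (subspace [set t : R | 0 <= t]) _ _ x
  (fun v => (row i M *m v) 0 0)); first exact: cx.
exact: continuous_rowmul.
Qed.

(** Carries to all times an equation known almost surely at each fixed time:
    only countably many exceptional null sets can be discarded. *)
Lemma eq_from_rat (h : R -> R) :
  (forall t : R, 0 < t -> {for t, continuous h}) ->
  (forall q : rat, 0 < ratr q :> R -> h (ratr q) = 0) ->
  forall t : R, 0 < t -> h t = 0.
Proof.
move=> ch hq t t0; apply/eqP/negP => /negP ht.
have /nbhs_ballP[e /= e0 he] : nbhs t [set s | h s != 0].
  exact: cvgr_neq0 (ch t t0) ht.
have [q] : exists q : rat, ratr q \in `]t, t + e[.
  by apply: rat_in_itvoo; rewrite ltrDl.
rewrite in_itv/= => /andP[tq qe].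
have : h (ratr q) != 0.
  by apply: he; rewrite /ball/= ltr_distlC; apply/andP; split; lra.
by rewrite hq ?eqxx// (lt_trans t0).
Qed.

Lemma is_derive_continuous (h : R -> R) (t dh : R) :
  is_derive t (1 : R) h dh -> {for t, continuous h}.
Proof.
by case=> /derivable1_diffP dht _; exact: differentiable_continuous.
Qed.

Definition integral_path n (M : 'M[R]_n) (x : R -> 'cV[R]_n) (t : R) :
    'cV[R]_n :=
  \col_i Rintegral lebesgue_measure `[0, t] (fun s => (M *m x s) i 0).

Definition difference_equation n (A : 'M[R]_n) (xi : 'cV[R]_n)
    (x y : R -> 'cV[R]_n) (t : R) : Prop :=
  x t - y t = xi + integral_path A x t - integral_path (- 1%:M) y t.

(** The integral equation says that x - y is an integral only at rational
    times; continuity extends this to all positive times, where the fundamental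
    theorem of calculus applies. *)
Lemma is_derive_difference n (A : 'M[R]_n) (xi : 'cV[R]_n)
    (x y : R -> 'cV[R]_n) :
  continuous_on_halfline x -> continuous_on_halfline y ->
  (forall q : rat, 0 < ratr q :> R -> difference_equation A xi x y (ratr q)) ->
  forall t : R, 0 < t -> forall i,
    is_derive t (1 : R) (fun s => (x s - y s) i 0) ((A *m x t + y t) i 0).
Proof.
move=> cx cy xy t t0 i.
pose G s := Rintegral lebesgue_measure `[0, s] (fun s => (A *m x s) i 0).
pose H s := Rintegral lebesgue_measure `[0, s]
  (fun s => ((- 1%:M : 'M[R]_n) *m y s) i 0).
have dG (s : R) : 0 < s -> is_derive s (1 : R) G ((A *m x s) i 0).
  by move=> s0; apply: is_derive_integral => //;
    exact: continuous_on_halfline_mulmx.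
have dH (s : R) : 0 < s ->
    is_derive s (1 : R) H (((- 1%:M : 'M[R]_n) *m y s) i 0).
  by move=> s0; apply: is_derive_integral => //;
    exact: continuous_on_halfline_mulmx.
have coord (v : R -> 'cV[R]_n) : continuous_on_halfline v ->
    continuous_on_halfline (fun s => v s i 0 : R).
  move=> cv; have := @continuous_on_halfline_mulmx n n 1%:M i v cv.
  by under eq_fun do rewrite mul1mx.
have E (s : R) : 0 < s -> (x s - y s) i 0 - (xi i 0 + G s - H s) = 0.
  move: s; apply: eq_from_rat => [s s0|q q0]; last first.
    by rewrite xy// !mxE subrr.
  have cG := is_derive_continuous (dG s s0).
  have cH := is_derive_continuous (dH s s0).
  have cxi := halfline_continuous_at (coord _ cx) s0.
  have cyi := halfline_continuous_at (coord _ cy) s0.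
  rewrite [X in {for _, continuous X}](_ : _ =
    fun s => (x s i 0 - y s i 0) - (xi i 0 + G s - H s)); last first.
    by apply/funext => u; rewrite !mxE.
  apply: cvgB; first exact: cvgB.
  by apply: cvgB => //; apply: cvgD => //; exact: cvg_cst.
have dGt := dG t t0; have dHt := dH t t0.
apply: (@near_eq_is_derive _ _ _ (fun s => xi i 0 + G s - H s)).
  near=> s; apply/esym/eqP; rewrite -subr_eq0; apply/eqP/E.
  by near: s; exact: lt_nbhsr.
apply: is_derive_eq.
by rewrite mulNmx mul1mx !mxE; ring.
Unshelve. all: by end_near. Qed.

Lemma eventually_bounded_mulmx m n (M : 'M[R]_(m, n)) :
  exists2 K : R, 0 <= K & forall f (c : R), 0 < c -> eventually_bounded c f ->
    eventually_bounded (K * c) (fun t => M *m f t).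
Proof.
have /choice [K /all_and2 [K_ge0 MK]] : forall i, exists K : R, 0 <= K /\
    forall (x : 'cV[R]_n) (c : R), (forall i, `|x i 0| <= c) ->
    `|(row i M *m x) 0 0| <= K * c.
  by move=> i; have [K] := rowmul_bound (row i M); exists K.
exists (\sum_i K i); first exact: sumr_ge0.
move=> f c c0 fc; near=> t => i.
have ftc : forall i, `|f t i 0| <= c by near: t.
have := MK i _ _ ftc; rewrite -row_mul [X in `|X|]mxE => /le_trans; apply.
by rewrite ler_pM2r// (bigD1 i)//= lerDl sumr_ge0.
Unshelve. all: by end_near. Qed.

(** The two readings A z + (1 + A) y and - z + (1 + A) x of the derivative
    A x + y of z = x - y. *)
Lemma comparison_bound n (A : 'M[R]_n) : all_eigenvalues_re_neg A ->
  exists2 K : R, 0 < K & forall (xi : 'cV[R]_n) (x y : R -> 'cV[R]_n),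
    continuous_on_halfline x -> continuous_on_halfline y ->
    (forall q : rat, 0 < ratr q :> R ->
      difference_equation A xi x y (ratr q)) ->
    forall c : R, 0 < c ->
      (eventually_bounded c y -> eventually_bounded (K * c) x) /\
      (eventually_bounded c x -> eventually_bounded (K * c) y).
Proof.
move=> hA.
have [K1 K1_ge0 AK1] := stable_bounded hA.
have [K2 K2_ge0 AK2] := stable_bounded (@stableN1 R n).
have [L L_ge0 AL] := eventually_bounded_mulmx (1%:M + A).
(* L may vanish, while [stable_bounded] asks for a positive bound. *)
have L1 f (c : R) : 0 < c -> eventually_bounded c f ->
    eventually_bounded ((L + 1) * c) (fun t => (1%:M + A) *m f t).
  move=> c0 /AL-/(_ c0); apply: filterS => t fc i.
  by rewrite (le_trans (fc i))// ler_pM2r// lerDl.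
exists (K1 * (L + 1) + K2 * (L + 1) + 1).
  by rewrite ltr_wpDl// addr_ge0// mulr_ge0// addr_ge0.
move=> xi x y cx cy xy c c0.
have Lc0 : 0 < (L + 1) * c by rewrite mulr_gt0// ltr_wpDl.
have [a0 b0] : 0 <= K1 * ((L + 1) * c) /\ 0 <= K2 * ((L + 1) * c).
  by split; rewrite mulr_ge0// ltW.
have dz := is_derive_difference cx cy xy.
split=> [yc|xc].
- have zc : eventually_bounded (K1 * ((L + 1) * c)) (fun t => x t - y t).
    apply: (AK1 _ (fun t => (1%:M + A) *m y t)) => //; last exact: L1.
    near=> t => i.
    have -> : A *m (x t - y t) + (1%:M + A) *m y t = A *m x t + y t.
      by rewrite mulmxBr mulmxDl mul1mx [y t + _]addrC addrA subrK.
    by apply: dz; near: t; apply: nbhs_pinfty_gt; exact: num_real.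
  near=> t => i.
  have yt : forall i, `|y t i 0| <= c by near: t.
  have zt : forall i, `|(x t - y t) i 0| <= K1 * ((L + 1) * c) by near: t.
  have := zt i; rewrite !mxE => zti.
  rewrite -[x t i 0](subrK (y t i 0)) (le_trans (ler_normD _ _))//.
  by rewrite (le_trans (lerD zti (yt i)))//; lra.
- have zc : eventually_bounded (K2 * ((L + 1) * c)) (fun t => x t - y t).
    apply: (AK2 _ (fun t => (1%:M + A) *m x t)) => //; last exact: L1.
    near=> t => i.
    have -> : - 1%:M *m (x t - y t) + (1%:M + A) *m x t = A *m x t + y t.
      by rewrite mulNmx mul1mx mulmxDl mul1mx opprB addrA subrK addrC.
    by apply: dz; near: t; apply: nbhs_pinfty_gt; exact: num_real.
  near=> t => i.
  have xt : forall i, `|x t i 0| <= c by near: t.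
  have zt : forall i, `|(x t - y t) i 0| <= K2 * ((L + 1) * c) by near: t.
  have := zt i; rewrite !mxE distrC => zti.
  rewrite -[y t i 0](subrK (x t i 0)) (le_trans (ler_normD _ _))//.
  by rewrite (le_trans (lerD zti (xt i)))//; lra.
Unshelve. all: by end_near. Qed.

Lemma cvg0_eventually_bounded n (f : R -> 'cV[R]_n) :
  f t @[t --> +oo] --> (0 : 'cV[R]_n) <->
  forall c : R, 0 < c -> eventually_bounded c f.
Proof.
split=> [/cvgr0Pnorm_le f0 c /f0|fc].
  apply: filterS => t + i; apply: le_trans.
  rewrite [leRHS]/Num.Def.normr/= mx_normrE.
  by apply/bigmax_geP; right; exists (i, 0).
apply/cvgr0Pnorm_le => c c0; move: (fc c c0); apply: filterS => t ftc.
rewrite [leLHS]/Num.Def.normr/= mx_normrE (bigmax_le _ (ltW c0))//=.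
move=> -[i j] _ /=; by rewrite (ord1 j).
Qed.

Lemma coord_le_enorm n (v : 'cV[R]_n) i : `|v i 0| <= enorm v.
Proof.
rewrite -sqrtr_sqr ler_sqrt ?sumr_ge0// => [|j _]; last exact: sqr_ge0.
by rewrite (bigD1 i)//= lerDl sumr_ge0// => j _; exact: sqr_ge0.
Qed.

Lemma enorm_le n (v : 'cV[R]_n) c :
  (forall i, `|v i 0| <= c) -> enorm v <= n%:R * c.
Proof.
case: n v => [|n] v vc.
  by rewrite /enorm big_ord0 sqrtr0 mul0r.
have c_ge0 : 0 <= c := le_trans (normr_ge0 _) (vc ord0).
rewrite -[leRHS]ger0_norm ?mulr_ge0// -sqrtr_sqr ler_sqrt ?sqr_ge0//.
apply: (@le_trans _ _ (\sum_(i < n.+1) c ^+ 2)).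
  apply: ler_sum => i _.
  by rewrite -real_normK ?num_real// ler_pXn2r// nnegrE.
rewrite sumr_const card_ord -[leLHS]mulr_natl exprMn ler_wpM2r ?sqr_ge0//.
by rewrite expr2 ler_peMl// ler1n.
Qed.

Lemma eventually_bounded_enorm n (f : R -> 'cV[R]_n) (c : R) :
  (\forall t \near +oo, enorm (f t) <= c) -> eventually_bounded c f.
Proof.
by apply: filterS => t fc i; rewrite (le_trans (coord_le_enorm _ i)).
Qed.

Lemma limsup_pinfty_lt (f : R -> R) (c : R) :
  (limsup_pinfty f < c%:E)%E -> \forall t \near +oo, f t <= c.
Proof.
move=> /ereal_inf_lt [_ [V nV <-] Vc]; apply: filterS nV => t Vt.
rewrite -lee_fin (le_trans _ (ltW Vc))//; apply: ereal_sup_ubound.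
by exists t.
Qed.

Lemma limsup_pinfty_le (f : R -> R) (c : R) :
  (\forall t \near +oo, f t <= c) -> (limsup_pinfty f <= c%:E)%E.
Proof.
move=> fc.
apply: (@le_trans _ _ (ereal_sup ((EFin \o f) @` [set t | f t <= c]))).
  by apply: ereal_inf_lbound; exists [set t | f t <= c].
by apply: ge_ereal_sup => _ [t ftc <-]; rewrite lee_fin.
Qed.

Lemma liminf_le_limsup_pinfty (f : R -> R) :
  (liminf_pinfty f <= limsup_pinfty f)%E.
Proof.
rewrite /liminf_pinfty limf_einfE; apply: ge_ereal_sup => _ [U nU <-].
apply: le_ereal_inf_tmp => _ [V nV <-].
have [t [Ut Vt]] := filter_ex (filterI nU nV).
apply: (@le_trans _ _ (f t)%:E).
  by apply: ereal_inf_lbound; exists t.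
by apply: ereal_sup_ubound; exists t.
Qed.

Lemma liminf_pinfty_ge0 (f : R -> R) :
  (forall t, 0 <= f t) -> (0 <= liminf_pinfty f)%E.
Proof.
move=> f0; rewrite /liminf_pinfty limf_einfE.
apply: (@le_trans _ _ (ereal_inf ((EFin \o f) @` setT))).
  by apply: le_ereal_inf_tmp => _ [t _ <-]; rewrite lee_fin.
by apply: ereal_sup_ubound; exists setT => //; exact: filterT.
Qed.

End Paths.

(** * Almost sure equality of stochastic integrals *)

Section ItoUniqueness.
Context {R : realType} {dT : measure_display} {T : measurableType dT}.
Context (P : probability T R) (F : R -> set (set T)).
Context (hF : is_filtration F).

Lemma measurable_at_measurable (t : R) (f : T -> R) :
  0 <= t -> measurable_at F t f -> measurable_fun setT f.
Proof.
move=> t0 mf _ U mU; rewrite setTI.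
by have [_ Ft] := hF.1 t t0; apply: Ft; exact: mf.
Qed.

Lemma step_time_ge0 (t : R) (phi : step_process) : is_simple_process F t phi ->
  forall k, (k <= step_size phi)%N -> 0 <= step_time phi k.
Proof.
case=> phi0 _ phi_mono _ _; elim=> [|k IHk] lt_k; first by rewrite phi0.
by rewrite (le_trans (IHk (ltnW lt_k)))// phi_mono.
Qed.

Lemma measurable_step_integral (W : R -> T -> R) (t : R) (phi : step_process) :
  (forall s, 0 <= s -> measurable_at F s (W s)) ->
  is_simple_process F t phi -> measurable_fun setT (step_integral W phi).
Proof.
move=> mW sphi; have phi0 := step_time_ge0 sphi.
case: sphi => _ _ _ mphi _.
apply: measurable_sum => k; have ltk := ltn_ord k.
apply: measurable_funM.
  exact: measurable_at_measurable (phi0 _ (ltnW ltk)) (mphi _ ltk).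
apply: measurable_funB.
  exact: measurable_at_measurable (phi0 _ ltk) (mW _ (phi0 _ ltk)).
exact: measurable_at_measurable (phi0 _ (ltnW ltk)) (mW _ (phi0 _ (ltnW ltk))).
Qed.

(** Two limits in L^2(P) of the same step integrals agree: integrating
    (I - J)^2 / 2 <= (S_n - I)^2 + (S_n - J)^2, where S_n is the step integral
    of the n-th approximation, shows that I - J has zero L^2 norm. *)
Lemma ito_integral_unique (W : R -> T -> R) (t : R) (f : R -> T -> R)
    (I J : T -> R) :
  (forall s, 0 <= s -> measurable_at F s (W s)) ->
  is_ito_integral P F W t f I -> is_ito_integral P F W t f J ->
  {ae P, forall w, I w = J w}.
Proof.
move=> mW [mI [phi aphi] /(_ _ aphi) Iphi] [mJ _ /(_ _ aphi) Jphi].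
have mS n : measurable_fun setT (step_integral W (phi n)).
  exact: measurable_step_integral (aphi.1 n).
have msq (K : T -> R) n : measurable_fun setT K ->
    measurable_fun setT
      (fun w => ((step_integral W (phi n) w - K w) ^+ 2)%:E).
  move=> mK; apply/measurable_EFinP; apply: measurable_funX.
  exact: measurable_funB.
pose D w : \bar R := (((I w - J w) ^+ 2) / 2)%:E.
have mD : measurable_fun setT D.
  apply/measurable_EFinP; apply: measurable_funM => //.
  by apply: measurable_funX; exact: measurable_funB.
have D0 w : (0 <= D w)%E by rewrite lee_fin divr_ge0// sqr_ge0.
have intD_le0 : (\int[P]_w D w <= 0)%E.
  have IJ := @cvgeD _ _ eventually_filter _ _ _ _ _
    (isT : ((0 : \bar R) +? 0)%E) Iphi Jphi.
  rewrite adde0 in IJ; apply: (cvge_ge _ IJ); apply: nearW => n.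
  rewrite -ge0_integralD//;
    do 2?[exact: msq | by move=> w _; rewrite lee_fin sqr_ge0].
  apply: ge0_le_integral => //.
  - by apply: emeasurable_funD; exact: msq.
  - move=> w _; rewrite /D -EFinD lee_fin.
    rewrite -subr_ge0; set s := step_integral _ _ _.
    rewrite [leRHS](_ : _ = (2 * s - I w - J w) ^+ 2 / 2); last by field.
    by rewrite divr_ge0// sqr_ge0.
have : (\int[P]_w `|D w| = 0)%E.
  under eq_integral do rewrite gee0_abs//.
  by apply/eqP; rewrite eq_le intD_le0 integral_ge0.
move=> /(ae_eq_integral_abs P measurableT mD).1.
apply: filterS => w /(_ Logic.I) [] /eqP.
by rewrite mulf_eq0 invr_eq0 pnatr_eq0 orbF sqrf_eq0 subr_eq0 => /eqP.
Qed.

Lemma ito_integral_mx_unique (d r : nat) (B : R -> T -> 'cV[R]_r) (t : R)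
    (sigma : R -> 'M[R]_(d, r)) (M N : T -> 'cV[R]_d) :
  adapted F B -> is_ito_integral_mx P F B t sigma M ->
  is_ito_integral_mx P F B t sigma N -> {ae P, forall w, M w = N w}.
Proof.
move=> aB [I [hI MI]] [J [hJ NJ]].
have IJ i j : {ae P, forall w, I i j w = J i j w}.
  by apply: ito_integral_unique (hI i j) (hJ i j) => s s0; exact: aB.
have : {ae P, forall w, forall i j, I i j w = J i j w}.
  by apply: filter_forall => i; apply: filter_forall => j; exact: IJ.
apply: filterS => w IJw; apply/colP => i; rewrite MI NJ.
by apply: eq_bigr => j _; exact: IJw.
Qed.

(** The stochastic integrals in the two equations are almost surely equal at
    each time, hence simultaneously at all rational times. *)
Lemma sde_difference (d r : nat) (B : R -> T -> 'cV[R]_r)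
    (sigma : R -> 'M[R]_(d, r)) (A : 'M[R]_d) (xi : 'cV[R]_d)
    (X Y : R -> T -> 'cV[R]_d) : adapted F B ->
  is_sde_solution P F B (fun x => A *m x) sigma xi X ->
  is_sde_solution P F B (fun y => - y) sigma 0 Y ->
  {ae P, forall w, forall q : rat, 0 < ratr q :> R ->
    difference_equation A xi (X ^~ w) (Y ^~ w) (ratr q)}.
Proof.
move=> aB [_ _ _ eX] [_ _ _ eY].
have eXY (t : R) : 0 <= t ->
    {ae P, forall w, difference_equation A xi (X ^~ w) (Y ^~ w) t}.
  move=> t0; have [M [hM XM]] := eX t t0; have [N [hN YN]] := eY t t0.
  have MN := ito_integral_mx_unique aB hM hN.
  apply: filterS3 XM YN MN => w Xw Yw MNw.
  have NY : integral_path (- 1%:M) (Y ^~ w) t =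
      \col_i Rintegral lebesgue_measure `[0, t] (fun s => (- Y s w) i 0).
    apply/colP => i; rewrite !mxE; congr (Rintegral _ _ _).
    by apply/funext => s; rewrite mulNmx mul1mx.
  by rewrite /difference_equation Xw Yw MNw NY add0r opprD addrACA subrr addr0.
have : {ae P, forall w, forall n : nat,
    if unpickle n is Some q then 0 < ratr q :> R ->
      difference_equation A xi (X ^~ w) (Y ^~ w) (ratr q : R) else True}.
  apply: ae_foralln => n; case: (unpickle n) => [q|]; last exact: aeW.
  have [q0|q0] := ltP 0 (ratr q : R); last exact: aeW.
  by apply: filterS (eXY _ (ltW q0)) => w.
by apply: filterS => w eq_w q; have := eq_w (pickle q); rewrite pickleK.
Qed.

End ItoUniqueness.

(** * Asymptotic comparison of the two solutions *)

Theorem theorem1 (R : realType) (d r : nat) (hd : (0 < d)%N) (hr : (0 < r)%N)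
    (dT : measure_display) (T : measurableType dT) (P : probability T R)
    (F : R -> set (set T)) (hF : is_filtration F)
    (B : R -> T -> 'cV[R]_r) (hB : is_brownian_motion P F B)
    (A : 'M[R]_d) (hA : all_eigenvalues_re_neg A)
    (sigma : R -> 'M[R]_(d, r)) (hsigma : continuous_on_halfline sigma)
    (xi : 'cV[R]_d) (Y X : R -> T -> 'cV[R]_d)
    (hY : is_sde_solution P F B (fun y => - y) sigma 0 Y)
    (hX : is_sde_solution P F B (fun x => A *m x) sigma xi X) :
  [/\ {ae P, forall w, Y t w @[t --> +oo] --> (0 : 'cV[R]_d)} ->
      {ae P, forall w, X t w @[t --> +oo] --> (0 : 'cV[R]_d)},
      (exists c1 c2 : R, [/\ 0 <= c1, c1 <= c2 &
        {ae P, forall w,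
          [/\ (c1%:E <= liminf_pinfty (fun t => enorm (Y t w)))%E,
              (liminf_pinfty (fun t => enorm (Y t w)) <=
               limsup_pinfty (fun t => enorm (Y t w)))%E &
              (limsup_pinfty (fun t => enorm (Y t w)) <= c2%:E)%E]}]) ->
      (exists c3 c4 : R, [/\ 0 <= c3, c3 <= c4 &
        {ae P, forall w,
          [/\ (c3%:E <= liminf_pinfty (fun t => enorm (X t w)))%E,
              (liminf_pinfty (fun t => enorm (X t w)) <=
               limsup_pinfty (fun t => enorm (X t w)))%E &
              (limsup_pinfty (fun t => enorm (X t w)) <= c4%:E)%E]}]) &
      {ae P, forall w, limsup_pinfty (fun t => enorm (Y t w)) = +oo%E} ->
      {ae P, forall w, limsup_pinfty (fun t => enorm (X t w)) = +oo%E}].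
Proof.
have [K K0 AK] := comparison_bound hA.
have {AK} ae_comparison : {ae P, forall w, forall c : R, 0 < c ->
    (eventually_bounded c (Y ^~ w) -> eventually_bounded (K * c) (X ^~ w)) /\
    (eventually_bounded c (X ^~ w) -> eventually_bounded (K * c) (Y ^~ w))}.
  have eXY := sde_difference hF (brownian_adapted hB) hX hY.
  have [_ cX _ _] := hX; have [_ cY _ _] := hY.
  by apply: filterS3 cX cY eXY => w; exact: AK.
split.
- apply: filterS2 ae_comparison => w XYw /cvg0_eventually_bounded Y0.
  apply/cvg0_eventually_bounded => c c0.
  have cK0 : 0 < c / K by rewrite divr_gt0.
  by have := (XYw _ cK0).1 (Y0 _ cK0); rewrite mulrC divfK// gt_eqF.
- move=> [c1 [c2 [c1_ge0 c12 Yc]]].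
  have c20 : 0 < c2 + 1 by rewrite ltr_wpDl// (le_trans c1_ge0).
  exists 0, (d%:R * (K * (c2 + 1))); split => //.
    by rewrite !mulr_ge0 ?(ltW K0) ?(ltW c20).
  apply: filterS2 ae_comparison Yc => w XYw [_ _ Yw]; split.
  + by apply: liminf_pinfty_ge0 => t; exact: sqrtr_ge0.
  + exact: liminf_le_limsup_pinfty.
  + apply: limsup_pinfty_le.
    have Yb : eventually_bounded (c2 + 1) (Y ^~ w).
      apply/eventually_bounded_enorm/limsup_pinfty_lt.
      by rewrite (le_lt_trans Yw)// lte_fin ltrDl.
    apply: filterS ((XYw _ c20).1 Yb) => t; exact: enorm_le.
- (* A finite limsup of |X| would make Y eventually bounded. *)
  apply: filterS2 ae_comparison => w XYw Yoo.
  apply: contrapT => /eqP; rewrite -ltey => Xlt.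
  have [c c0 Xc] : exists2 c : R, 0 < c & eventually_bounded c (X ^~ w).
    have X_ge0 : (0 <= limsup_pinfty (fun t => enorm (X t w)))%E.
      apply: le_trans (liminf_le_limsup_pinfty _).
      by apply: liminf_pinfty_ge0 => t; exact: sqrtr_ge0.
    have Xfin : limsup_pinfty (fun t => enorm (X t w)) \is a fin_num.
      by rewrite ge0_fin_numE.
    exists (fine (limsup_pinfty (fun t => enorm (X t w))) + 1).
      by rewrite ltr_wpDl// fine_ge0.
    apply/eventually_bounded_enorm/limsup_pinfty_lt.
    by rewrite EFinD fineK// lteDl// lte_fin.
  have : (limsup_pinfty (fun t => enorm (Y t w)) <= (d%:R * (K * c))%:E)%E.
    apply: limsup_pinfty_le.
    by apply: filterS ((XYw _ c0).2 Xc) => t; exact: enorm_le.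
  by rewrite Yoo leye_eq.
Qed.
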